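(* Let $\bar{\mathcal D}_{tr}$ be labeled preference data generated from a prompt distribution $\mathcal D_x$, a reference policy $\pi_{\rm ref}(y|x)$ and a ground-truth preference distribution $p^*$, such that: (1) prompts are split between two disjoint support partitions, i.e. $x\in d_x^{good}\cup d_x^{bad}$ with probability one and $d_x^{good}\cap d_x^{bad}=\emptyset$; (2) for each prompt $x\in d_x^{good}\cup d_x^{bad}$, the preference distribution is supported on a single (prompt-dependent) response pair $\{y_1,y_2\}$; (3) pairwise preferences are dictated by a ground-truth Bradley–Terry model with $p^*(y_1\succ y_2|x)\in(0,1)$ for all $x\in d_x^{good}\cup d_x^{bad}$. Let $\pi^*$ be the BT-optimal policy, let $\mathrm{dist}[\cdot,\cdot]$ be an arbitrary distance measure, and assume $\pi_{\rm ref}(\cdot|x)=\pi^*(\cdot|x)$ for $x\in d_x^{good}$ and $\mathrm{dist}[\pi_{\rm ref},\pi^*]>0$ for $x\in d_x^{bad}$. Let $\hat\pi_\theta^{\rm TYPO}:=\arg\min_{\pi_\theta}\ell_{\rm TYPO}(\pi_\theta,\pi_{\rm ref},\lambda)$. Then $\hat\pi_\theta^{\rm TYPO}=\pi^*$ for all $x\in d_x^{good}$, including in cases where $\mathrm{dist}[\hat\pi_\theta^{\rm TYPO},\pi^*]<\mathrm{dist}[\pi_{\rm ref},\pi^*]$ for $x\in d_x^{bad}$.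
   Context: A policy $\pi(y|x)$ is a conditional probability distribution over responses $y$ given a prompt $x$; minimization over $\pi_\theta$ is over all policies (unconstrained). Data: $\{y_w,y_l,x\}\sim\mathcal D_{tr}$ means $x\sim\mathcal D_x$, then $y_1\neq y_2$ are drawn from $\pi_{\rm ref}(\cdot|x)$, then $z\in\{0,1\}$ with $\Pr(z=1)=p^*(z=1|y_1,y_2,x)=p^*(y_1\succ y_2|x)$; $(y_w,y_l)=(y_1,y_2)$ if $z=1$, else $(y_2,y_1)$. Bradley–Terry (BT): $p^*(y_1\succ y_2|x)=\frac{\exp r^*(y_1,x)}{\exp r^*(y_1,x)+\exp r^*(y_2,x)}$ for a latent reward $r^*$. BT-optimal policy: $\pi^*(y|x)=\exp[r^*(y,x)]/\sum_{y'}\exp[r^*(y',x)]$, so $p^*(y_1\succ y_2|x)=\frac{\pi^*(y_1|x)}{\pi^*(y_1|x)+\pi^*(y_2|x)}$. TYPO loss: for $\lambda>0$, $\ell_{\rm TYPO}(\pi_\theta,\pi_{\rm ref},\lambda):=\ell_{\rm sup}(\pi_\theta)+\lambda\,\ell_{\rm unsup}(\pi_\theta,\pi_{\rm ref})$, where $$\ell_{\rm sup}(\pi_\theta)=\mathbb E_{x\sim\mathcal D_x,\{y_1,y_2\}\sim\pi_{\rm ref}(y|x)}\Big[\mathrm{KL}\big[p^*(z|y_1,y_2,x)\,\|\,p_\theta(z|y_1,y_2,x)\big]\Big],$$ which equals $\mathbb E_{\{y_w,y_l,x\}\sim\mathcal D_{tr}}\big[\log\big(1+\tfrac{\pi_\theta(y_l|x)}{\pi_\theta(y_w|x)}\big)\big]$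 up to a constant independent of $\pi_\theta$, with $p_\theta(z=1|y_1,y_2,x)=\frac{\pi_\theta(y_1|x)}{\pi_\theta(y_1|x)+\pi_\theta(y_2|x)}$ and $p_\theta(z=0|y_1,y_2,x)=\frac{\pi_\theta(y_2|x)}{\pi_\theta(y_1|x)+\pi_\theta(y_2|x)}$; and $$\ell_{\rm unsup}(\pi_\theta,\pi_{\rm ref})=\mathbb E_{x\sim\mathcal D_x}\big[\mathrm{KL}[\pi_{\rm ref}(y|x)\,\|\,\pi_\theta(y|x)]\big],$$ which equals $-\mathbb E_{x\sim\mathcal D_x,\,y\sim\pi_{\rm ref}(y|x)}[\log\pi_\theta(y|x)]$ up to a constant independent of $\pi_\theta$.
   Formalization: ''For all x in d_good'' is proved for almost every such x and for every such x of positive probability; at prompts of probability zero the loss does not constrain the minimizer, so the literal claim fails there. *)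

(* Defs.v *)
From HB Require Import structures.
From mathcomp Require Import all_boot all_order all_algebra.
From mathcomp Require Import all_classical all_reals all_analysis.

Set Implicit Arguments.
Unset Strict Implicit.
Unset Printing Implicit Defensive.
Import Order.TTheory GRing.Theory Num.Theory.

Local Open Scope classical_set_scope.
Local Open Scope ring_scope.
Local Open Scope ereal_scope.

(* A policy is a probability kernel [pi : R.-pker X ~> Y] from prompts to
   responses; pi(y|x) is [pi x [set y]].  Responses are discrete: every
   statement below is used with Y countable with measurable singletons. *)
Definition discrete_space d (Y : measurableType d) : Prop :=
  countable [set: Y] /\ forall y : Y, measurable [set y].

Section kl.
Context d (T : measurableType d) (R : realType).

(* KL[P || q] = E_{t ~ P} [log (P(t) / q(t))] for a discrete law P and a mass
   function q.  In \bar R, a / 0 = +oo for a > 0 and lne +oo = +oo, so a point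
   with P(t) > 0 = q(t) contributes +oo; points with P(t) = 0 are P-null. *)
Definition KL (P : {measure set T -> \bar R}) (q : T -> \bar R) : \bar R :=
  \int[P]_t lne (P [set t] / q t).

End kl.

Section bradley_terry.
Context (X : Type) (Y : choiceType) (R : realType).

(* Latent rewards may be -oo: exp(-oo) = 0 excludes the response y at the
   prompt x.  This is how the set of admissible responses, hence the sum over
   y' in the BT-optimal policy, may depend on the prompt.  A softmax that is a
   probability law forces r x y < +oo and a finite nonzero normalizer. *)
Definition bt_pref (r : X -> Y -> \bar R) (x : X) (y1 y2 : Y) : \bar R :=
  expeR (r x y1) / (expeR (r x y1) + expeR (r x y2)).

Definition bt_softmax (r : X -> Y -> \bar R) (x : X) (y : Y) : \bar R :=
  expeR (r x y) / \esum_(y' in [set: Y]) expeR (r x y').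

End bradley_terry.

Section pairs.
Context d (Y : measurableType d) (R : realType).

(* Law of an ordered pair of independent draws from P conditioned on the two
   responses being distinct; identically 0 when P is a point mass. *)
Definition pair_law (P : {measure set Y -> \bar R}) (y : Y * Y) : \bar R :=
  if y.1 == y.2 then 0
  else P [set y.1] * P [set y.2] / \int[P]_u P [set~ u].

Definition pair_support (P : {measure set Y -> \bar R}) : set (Y * Y) :=
  [set y | 0 < pair_law P y].

End pairs.

Section loss.
Context dX dY (X : measurableType dX) (Y : measurableType dY) (R : realType).

(* p_theta(z | y1, y2, x); z = true means that y1 is preferred to y2.  If both
   policy masses vanish this is 0 for both z, and the KL term below is +oo. *)
Definition p_theta (pi : R.-pker X ~> Y) (x : X) (y1 y2 : Y) (z : bool)
    : \bar R :=
  pi x [set if z then y1 else y2] / (pi x [set y1] + pi x [set y2]).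

Definition l_sup (D : probability X R) (r : X -> Y -> \bar R)
    (pref pi : R.-pker X ~> Y) : \bar R :=
  \int[D]_x \esum_(y in [set: Y * Y])
    (pair_law (pref x) y *
     KL (bernoulli_prob (fine (bt_pref r x y.1 y.2))) (p_theta pi x y.1 y.2)).

Definition l_unsup (D : probability X R) (pref pi : R.-pker X ~> Y) : \bar R :=
  \int[D]_x KL (pref x) (fun y => pi x [set y]).

Definition l_TYPO (D : probability X R) (r : X -> Y -> \bar R) (lambda : R)
    (pref pi : R.-pker X ~> Y) : \bar R :=
  l_sup D r pref pi + lambda%:E * l_unsup D pref pi.

Definition is_TYPO_argmin (D : probability X R) (r : X -> Y -> \bar R)
    (lambda : R) (pref pihat : R.-pker X ~> Y) : Prop :=
  forall pi : R.-pker X ~> Y,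
    l_TYPO D r lambda pref pihat <= l_TYPO D r lambda pref pi.

End loss.

Section distance.
Context d (Y : measurableType d) (R : realType).

(* Symmetry, finiteness and the triangle inequality are not required, so that
   both metrics and divergences qualify. *)
Definition is_distance
    (dist : {measure set Y -> \bar R} -> {measure set Y -> \bar R} -> \bar R)
    : Prop :=
  forall p q : {measure set Y -> \bar R}, p [set: Y] = 1 -> q [set: Y] = 1 ->
    0 <= dist p q /\
    (dist p q = 0 <-> forall A, measurable A -> p A = q A).

Definition tv_dist (p q : {measure set Y -> \bar R}) : \bar R :=
  ereal_sup [set `|p A - q A| | A in measurable].

End distance.

Record preference_data dX dY (X : measurableType dX) (Y : measurableType dY)
    (R : realType) (D : probability X R) (good bad : set X)
    (r : X -> Y -> \bar R) (pref pistar : R.-pker X ~> Y)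
    (dist : {measure set Y -> \bar R} -> {measure set Y -> \bar R} -> \bar R)
    : Prop := PreferenceData {
  pd_discrete : discrete_space Y;
  pd_good_meas : measurable good;
  pd_bad_meas : measurable bad;
  pd_disjoint : good `&` bad = set0;
  pd_cover : D (good `|` bad) = 1;
  pd_pair : forall x, (good `|` bad) x ->
    exists y1 y2 : Y, [/\ y1 != y2,
      pair_support (pref x) = [set (y1, y2); (y2, y1)],
      0 < bt_pref r x y1 y2 & bt_pref r x y1 y2 < 1];
  pd_BT_optimal : forall x y, pistar x [set y] = bt_softmax r x y;
  pd_dist : is_distance dist;
  pd_good : forall x, good x -> forall y, pref x [set y] = pistar x [set y];
  pd_bad : forall x, bad x -> 0 < dist (pref x) (pistar x) }.

(* Main.v *)
(* On a good prompt pref equals pistar, which makes both the supervised KL term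
   and KL[pref || pi] vanish at pi = pref.  Replacing an optimal policy by pref
   on the good prompts thus cannot increase the supervised loss, so optimality
   forces the integral of KL[pref || pihat] over the good prompts to be 0, and
   the equality case of Gibbs' inequality concludes.  All subtractions require
   the optimal loss to be finite, which is witnessed by the policy that is
   uniform on the response pair of each prompt.

   For the strict improvement on bad prompts, take two prompts, two responses
   and a constant reward: at a prompt where pref has masses (w, 1 - w) the
   minimizer is the mixture (pistar + lambda pref) / (1 + lambda), whose
   distance to pistar is lambda / (1 + lambda) times that of pref. *)
Require Import Defs.
From HB Require Import structures.
From mathcomp Require Import all_boot all_order all_algebra.
From mathcomp Require Import all_classical all_reals all_analysis.
From mathcomp Require Import measurable_realfun ring lra.

Set Implicit Arguments.
Unset Strict Implicit.
Unset Printing Implicit Defensive.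
Import Order.TTheory GRing.Theory Num.Theory.

Local Open Scope classical_set_scope.
Local Open Scope ring_scope.
Local Open Scope ereal_scope.

(* Latent rewards are not assumed measurable in the prompt, so the integrand of
   the supervised loss is handled as an arbitrary nonnegative function. *)
Section nonmeasurable_integrands.
Context d (T : measurableType d) (R : realType).
Variable mu : {measure set T -> \bar R}.
Implicit Types (f g : T -> \bar R).
Import HBNNSimple.

(** The integral of a nonnegative function is a supremum over the simple functions below it, and
    this supremum grows with the function whether or not it is measurable. *)
Lemma ge0_le_integral_nonmeasurable f g : (forall x, 0 <= f x) ->
  (forall x, f x <= g x) -> \int[mu]_x f x <= \int[mu]_x g x.
Proof.
move=> f0 fg; have g0 x : 0 <= g x by exact: le_trans (fg x).
rewrite !ge0_integralTE//; apply: le_ereal_sup => _ [h hf <-] /=.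
by exists h => // x; exact: le_trans (fg x).
Qed.

(** A simple function below [f], cut to 0 on [N], is a simple function below the restriction of [f]
    and has the same integral, so the two suprema agree. *)
Lemma ge0_integral_negligibleC f (N : set T) : measurable N -> mu N = 0 ->
  (forall x, 0 <= f x) -> \int[mu]_x f x = \int[mu]_(x in ~` N) f x.
Proof.
move=> mN N0 f0; apply/eqP; rewrite eq_le; apply/andP; split; last first.
  rewrite [leLHS]integral_mkcond; apply: ge0_le_integral_nonmeasurable => x.
    exact: erestrict_ge0.
  by rewrite patchE; case: ifP.
rewrite [leRHS]integral_mkcond !ge0_integralTE//; last first.
  by move=> x; exact: erestrict_ge0.
apply: ge_ereal_sup => _ [h hf <-] /=.
have mNC : measurable (~` N) by exact: measurableC.
have [k hE] : exists k : {nnsfun T >-> R}, k =1 h \_ (~` N).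
  by exists (proj_nnsfun h mNC) => x; rewrite mrestrict.
apply: ereal_sup_ubound; exists k => /=.
  by move=> x; have := hf x; rewrite hE !patchE; case: ifP.
rewrite -[LHS]integralT_nnsfun -[RHS]integralT_nnsfun.
rewrite [RHS](ge0_negligible_integral mN)//; last 2 first.
- exact/measurable_EFinP.
- by move=> x _; rewrite lee_fin.
rewrite [LHS](ge0_negligible_integral mN)//; last 2 first.
- exact/measurable_EFinP.
- by move=> x _; rewrite lee_fin.
apply: eq_integral => x; rewrite in_setD => /andP[_ xN].
by rewrite hE patchE in_setC xN.
Qed.

Lemma integral_negligibleC f (N : set T) : measurable N -> mu N = 0 ->
  \int[mu]_x f x = \int[mu]_(x in ~` N) f x.
Proof.
move=> mN N0; rewrite integralE [RHS]integralE.
by congr (_ - _); exact: ge0_integral_negligibleC.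
Qed.

End nonmeasurable_integrands.

(** * Finite measures carried by two points of a discrete space *)

Lemma mass1_le1 d (T : measurableType d) (R : realType)
    (P : {measure set T -> \bar R}) (A : set T) :
  P [set: T] = 1 -> measurable A -> P A <= 1.
Proof. by move=> <- mA; apply: le_measure; rewrite ?inE. Qed.

Lemma mass1_fin_num d (T : measurableType d) (R : realType)
    (P : {measure set T -> \bar R}) (A : set T) :
  P [set: T] = 1 -> measurable A -> P A \is a fin_num.
Proof.
by move=> P1 mA; rewrite ge0_fin_numE// (le_lt_trans (mass1_le1 P1 mA))// ltry.
Qed.

Section discrete_measures.
Context d (T : measurableType d) (R : realType).
Hypothesis discT : discrete_space T.
Variable P : {measure set T -> \bar R}.
Implicit Types (a b : T) (A : set T).

Lemma discrete_measurable A : measurable A.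
Proof.
have [cT mT] := discT.
by apply: countable_measurable mT _; apply: sub_countable cT;
  exact: subset_card_le.
Qed.

Lemma discrete_measurable_fun d' (S : measurableType d') (f : T -> S) A :
  measurable_fun A f.
Proof. by move=> _ B _; exact: discrete_measurable. Qed.

Variables (a b : T).
Hypotheses (ab : a != b) (Pab : P [set: T] = P [set a] + P [set b]).
Hypothesis Pfin : P [set: T] \is a fin_num.

Let mT A : measurable A := discrete_measurable A.

Let disj_ab : [set a] `&` [set b] = set0.
Proof.
by rewrite set1I ifF//; apply/negbTE; rewrite notin_setE /=; exact/eqP.
Qed.

Lemma two_points_null A : ~ A a -> ~ A b -> P A = 0.
Proof.
move=> Aa Ab.
have le : P A + (P [set a] + P [set b]) <= P [set: T].
  rewrite -!measureU//.
  - by apply: le_measure; rewrite ?inE.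
  - by apply/seteqP; split => // x [/= Ax [xa|xb]];
      [apply: Aa; rewrite -xa|apply: Ab; rewrite -xb].
apply/eqP; rewrite -measure_le0.
by move: le; rewrite -Pab -{2}(add0e (P setT)) (leeD2rE _ _ Pfin).
Qed.

Lemma two_points_measureE A :
  P A = P [set a] * (a \in A)%:R%:E + P [set b] * (b \in A)%:R%:E.
Proof.
have -> : P A = P (A `&` [set a]) + P (A `&` [set b]).
  rewrite -measureU//; last first.
    by rewrite setIACA setIid disj_ab setI0.
  rewrite -setIUr (measureDI P (mT A) (mT ([set a] `|` [set b]))).
  rewrite [X in X + _](_ : _ = 0) ?add0e//.
  by apply: two_points_null => -[_]; apply; [left|right].
have h c : P (A `&` [set c]) = P [set c] * (c \in A)%:R%:E.
  rewrite setI1; case: ifP; first by rewrite mule1.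
  by rewrite measure0 mule0.
by rewrite !h.
Qed.

(** Excluding only -oo makes the negative parts finite at both atoms, so positive and negative parts
    recombine even where [f] is +oo, as happens for relative entropies. *)
Lemma two_points_integral (f : T -> \bar R) : f a != -oo -> f b != -oo ->
  \int[P]_t f t = P [set a] * f a + P [set b] * f b.
Proof.
have fin c : P [set c] \is a fin_num.
  rewrite ge0_fin_numE//; apply: (@le_lt_trans _ _ (P setT)).
    by apply: le_measure; rewrite ?inE.
  by rewrite -ge0_fin_numE.
have nng c : exists k : {nonneg R}, P [set c] = k%:num%:E.
  have r0 : (0 <= fine (P [set c]))%R by exact: fine_ge0.
  by exists (NngNum r0); rewrite /= fineK.
have [[ka Pa] [kb Pb]] := (nng a, nng b).
(* The weighted sum of two Dirac masses that coincides with [P] on every set. *)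
pose m : {measure set T -> \bar R} :=
  measure_add (mscale ka \d_a) (mscale kb \d_b).
have intE (g : T -> \bar R) : (forall t, 0 <= g t) ->
    \int[P]_t g t = P [set a] * g a + P [set b] * g b.
  move=> g0; rewrite (eq_measure_integral m); last first.
    move=> A mA _; rewrite two_points_measureE [RHS]measure_addE Pa Pb.
    by rewrite /mscale; congr (_ * _ + _ * _); rewrite -diracE.
  have mg : measurable_fun setT g by exact: discrete_measurable_fun.
  rewrite /m ge0_integral_measure_add// !ge0_integral_mscale//.
  by rewrite !integral_dirac// !diracT !mul1e Pa Pb.
have fE c : f c = f^\+ c - f^\- c by rewrite {1}(funeposneg f).
have nfin c : f c != -oo -> f^\- c \is a fin_num.
  by rewrite funenegE; case: (f c) => [r||]// _; rewrite -?EFin_max ?maxNye.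
move=> fa fb; rewrite integralE !intE// (fE a) (fE b).
rewrite !muleBr//; try by rewrite fin_num_adde_defl// fin_numN nfin.
rewrite fin_num_oppeD ?fin_numM ?nfin//.
by rewrite addeACA.
Qed.

End discrete_measures.

(** * Binary relative entropy and Gibbs' inequality *)

Section relative_entropy.
Context {R : realType}.
Implicit Types p q : R.

(* KL of the law (p, 1 - p) relative to the masses (qa, qb), for 0 < p < 1. *)
Definition kl2 p qa qb : \bar R :=
  if (0 < qa)%R && (0 < qb)%R
  then (p * (ln p - ln qa) + (1 - p) * (ln (1 - p) - ln qb))%:E else +oo.

(** This is the strict inequality exp t > 1 + t at t = ln q - ln p, multiplied by p. *)
Lemma gibbs_pointwise p q : (0 < p)%R -> (0 < q)%R -> p != q ->
  (p - q < p * (ln p - ln q))%R.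
Proof.
move=> p0 q0 pq; have t0 : (ln q - ln p != 0)%R.
  rewrite subr_eq0; apply: contra pq => /eqP h.
  by rewrite eq_sym; apply/eqP/(@ln_inj R); rewrite ?posrE.
have := expR_gt1Dx t0; rewrite expRD expRN !lnK ?posrE//.
rewrite -(ltr_pM2l p0) mulrCA divff ?gt_eqF// mulr1; lra.
Qed.

Lemma kl2_refl p : (0 < p)%R -> (p < 1)%R -> kl2 p p (1 - p)%R = 0.
Proof. by move=> p0 p1; rewrite /kl2 p0 subr_gt0 p1/= !subrr !mulr0 addr0. Qed.

(** Adding the two pointwise bounds leaves 1 - (qa + qb) on the left, which is nonnegative for any
    subprobability; a single differing coordinate makes the sum strict. *)
Lemma kl2_gt0 p qa qb : (0 < p)%R -> (p < 1)%R -> (qa + qb <= 1)%R ->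
  ~ (qa = p /\ qb = 1 - p)%R -> 0 < kl2 p qa qb.
Proof.
move=> p0 p1 q1 qp; rewrite /kl2; case: ifP => // /andP[qa0 qb0].
rewrite lte_fin; have p1' : (0 < 1 - p)%R by lra.
have [pa|pa] := eqVneq p qa; have [pb|pb] := eqVneq (1 - p)%R qb.
- by case: qp.
- by rewrite -pa subrr mulr0 add0r; have := gibbs_pointwise p1' qb0 pb; lra.
- by rewrite -pb subrr mulr0 addr0; have := gibbs_pointwise p0 qa0 pa; lra.
- by have := gibbs_pointwise p1' qb0 pb; have := gibbs_pointwise p0 qa0 pa; lra.
Qed.

Lemma kl2_ge0 p qa qb : (0 < p)%R -> (p < 1)%R -> (qa + qb <= 1)%R ->
  0 <= kl2 p qa qb.
Proof.
move=> p0 p1 q1; have [[-> ->]|] := pselect (qa = p /\ qb = 1 - p)%R.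
  by rewrite kl2_refl.
by move=> /kl2_gt0 h; apply/ltW/h.
Qed.

Lemma measurable_kl2 d (X : measurableType d) (D : set X) (p qa qb : X -> R) :
  measurable D -> measurable_fun D p -> measurable_fun D qa ->
  measurable_fun D qb -> measurable_fun D (fun x => kl2 (p x) (qa x) (qb x)).
Proof.
move=> mD mp ma mb; have mln f : measurable_fun D f ->
    measurable_fun D (fun x => ln (f x) : R).
  by move=> mf; apply: measurableT_comp => //; exact: measurable_ln.
have m1p : measurable_fun D (fun x => 1 - p x)%R by exact: measurable_funB.
apply: measurable_fun_if => //.
  by apply: measurable_and; apply: measurable_fun_ltr.
apply/measurable_EFinP; apply: (@measurable_funS _ _ _ _ D) => //.
by apply: measurable_funD; apply: measurable_funM => //;
  apply: measurable_funB; exact: mln.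
Qed.

Lemma integral_le_bound_cst d (T : measurableType d)
    (P : {measure set T -> \bar R}) (f : T -> \bar R) (c : R) :
  P [set: T] = 1 -> (0 <= c)%R -> (forall t, f t <= c%:E) ->
  \int[P]_t f t <= c%:E.
Proof.
move=> P1 c0 fc; rewrite integralE; apply: (@le_trans _ _ (\int[P]_t f^\+ t)).
  by rewrite geeDl// oppe_le0 integral_ge0.
apply: (@le_trans _ _ (\int[P]_t (cst c%:E) t)).
  apply: ge0_le_integral_nonmeasurable => // t.
  by rewrite funeposE ge_max fc lee_fin.
by rewrite integral_cst// P1 mule1.
Qed.

End relative_entropy.

(** * Laws with two atoms: integrals, relative entropy and the pair law *)

Section two_point_measures.
Context d (T : measurableType d) (R : realType).
Hypothesis discT : discrete_space T.

Definition two_point (P : {measure set T -> \bar R}) (a b : T) (p : R) :=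
  [/\ a != b, (0 < p)%R, (p < 1)%R, P [set: T] = 1 &
     P [set a] = p%:E /\ P [set b] = (1 - p)%:E].

Section two_point_theory.
Variables (P : {measure set T -> \bar R}) (a b : T) (p : R).
Hypothesis Pab : two_point P a b p.

Let Psum : P [set: T] = P [set a] + P [set b].
Proof. by case: Pab => _ _ _ -> [-> ->]; rewrite -EFinD subrKC. Qed.

Let Pfin : P [set: T] \is a fin_num.
Proof. by case: Pab => _ _ _ ->. Qed.

Lemma two_point_integral (f : T -> \bar R) : f a != -oo -> f b != -oo ->
  \int[P]_t f t = p%:E * f a + (1 - p)%:E * f b.
Proof.
by case: Pab => ab _ _ _ [<- <-]; apply: two_points_integral.
Qed.

Lemma two_point_eq0 t : t != a -> t != b -> P [set t] = 0.
Proof.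
case: Pab => ab _ _ _ _ /eqP ta /eqP tb.
by apply: (two_points_null discT ab) => //= /esym.
Qed.

Lemma two_point_setC1 : P [set~ a] = (1 - p)%:E /\ P [set~ b] = p%:E.
Proof.
case: Pab => ab _ _ _ [Pa Pb].
have inC1 (u v : T) : (u \in [set~ v]) = (u != v) by rewrite in_setC in_set1.
have h A := two_points_measureE discT ab Psum Pfin A.
split; rewrite h Pa Pb !inC1 eqxx /= mule0.
  by rewrite eq_sym ab mule1 add0e.
by rewrite ab mule1 adde0.
Qed.

Lemma KL_two_point (q : T -> \bar R) (qa qb : R) :
  (0 <= qa)%R -> (0 <= qb)%R -> q a = qa%:E -> q b = qb%:E ->
  KL P q = kl2 p qa qb.
Proof.
case: Pab => ab p0 p1 _ [Pa Pb] qa0 qb0 qaE qbE.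
(* Division by zero of a positive number is +oo, which matches the second branch of [kl2]. *)
have lneE (u v : R) : (0 < u)%R -> (0 <= v)%R ->
    lne (u%:E / v%:E) = if (0 < v)%R then (ln u - ln v)%:E else +oo.
  move=> u0; rewrite le_eqVlt inver => /orP[/eqP <-|v0].
    by rewrite eqxx ltxx gt0_muley// lte_fin.
  by rewrite gt_eqF// v0 -EFinM lne_EFin ?divr_gt0// ln_div ?posrE.
have p1' : (0 < 1 - p)%R by rewrite subr_gt0.
rewrite /KL two_point_integral ?Pa ?Pb ?qaE ?qbE ?lneE//; try by case: ifP.
rewrite /kl2; case: ifP => _; case: ifP => _ //=.
- by rewrite gt0_muley// lte_fin.
- by rewrite gt0_muley// lte_fin.
- by rewrite !gt0_muley// lte_fin.
Qed.

(** The normalizer is 2p(1 - p) and each order of the pair has unnormalized mass p(1 - p), so the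
    value 1/2 does not depend on p. *)
Lemma pair_law_two_pointE (y : T * T) : pair_law P y =
  if (y == (a, b)) || (y == (b, a)) then (2^-1)%:E else 0.
Proof.
case: Pab => ab p0 p1 _ [Pa Pb]; rewrite /pair_law; case: y => y1 y2 /=.
have p1' : (0 < 1 - p)%R by rewrite subr_gt0.
rewrite two_point_integral//; last 2 first.
- by rewrite two_point_setC1.1.
- by rewrite two_point_setC1.2.
have [-> ->] := two_point_setC1; rewrite -!EFinM -EFinD.
have Z0 : (p * (1 - p) + (1 - p) * p != 0)%R.
  by rewrite gt_eqF// addr_gt0// mulr_gt0.
rewrite inver (negbTE Z0) !xpair_eqE.
have [->|y12] := eqVneq y1 y2.
  by have [->|] := eqVneq y2 a; rewrite ?(negbTE ab)//= andbF.
have [y1a|y1a] := eqVneq y1 a.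
  have [y2b|y2b] := eqVneq y2 b => /=.
    by rewrite y1a y2b Pa Pb -!EFinM; congr EFin; field; rewrite ?Z0//; lra.
  rewrite y1a (negbTE ab)/= (two_point_eq0 (t := y2)) ?mule0 ?mul0e//.
  by rewrite eq_sym -y1a.
have [y1b|y1b] := eqVneq y1 b => /=; last first.
  by rewrite (two_point_eq0 (t := y1)) ?mul0e.
have [y2a|y2a] := eqVneq y2 a.
  by rewrite y1b y2a Pa Pb -!EFinM; congr EFin; field; rewrite ?Z0//; lra.
by rewrite (two_point_eq0 (t := y2)) ?mule0 ?mul0e// eq_sym -y1b.
Qed.

Lemma pair_support_two_point : pair_support P = [set (a, b); (b, a)].
Proof.
apply/seteqP; split => y; rewrite /pair_support /= pair_law_two_pointE.
  by case: ifP => [/orP[/eqP ->|/eqP ->]|]; [left|right|rewrite ltxx].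
by move=> [->|->]; rewrite eqxx ?orbT/= lte_fin invr_gt0.
Qed.

Lemma esum_pair_law (c : \bar R) : 0 <= c ->
  \esum_(y in [set: T * T]) (pair_law P y * c) = c.
Proof.
move=> c0; case: Pab => ab _ _ _ _.
have hc : 0 <= (2^-1)%:E * c by rewrite mule_ge0// lee_fin invr_ge0.
rewrite (_ : \esum_(y in _) _ =
    \esum_(y in [set (a, b); (b, a)]) ((2^-1)%:E * c)); last first.
  rewrite [RHS]esum_mkcond; apply: eq_esum => y _; rewrite pair_law_two_pointE.
  by rewrite in_setU !in_set1; case: ifP => // _; rewrite mul0e.
rewrite esum_fset//.
rewrite fsbigU/=; last first.
- by move=> y [/= -> [ba _]]; rewrite ba eqxx in ab.
- exact: finite_set1.
- exact: finite_set1.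
rewrite !fsbig_set1 -ge0_muleDl ?lee_fin ?invr_ge0// -EFinD -div1r -splitr.
by rewrite mul1e.
Qed.

End two_point_theory.
End two_point_measures.

(** * Recovering two-point laws from pair supports; the equality case of Gibbs' inequality *)

Section discrete_probability.
Context d (T : measurableType d) (R : realType).
Hypothesis discT : discrete_space T.
Implicit Types P Q : {measure set T -> \bar R}.

Lemma discrete_measure_eq0 P (A : set T) :
  (forall t, A t -> P [set t] = 0) -> P A = 0.
Proof.
move=> A0; have [/countable_injP[f finj] mT] := discT.
suff [N [mN N0 AN]] : P.-negligible A.
  by apply: (subset_measure0 _ _ AN) => //; exact: discrete_measurable.
(* The injection [f] into the naturals cuts [A] into countably many pieces with at most one point
   each. *)
have -> : A = \bigcup_n (A `&` f @^-1` [set n]).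
  by apply/seteqP; split => [t At|t [n _ []//]]; exists (f t).
apply: negligible_bigcup => n.
have [[t [At ft]]|h] := pselect (exists t, A t /\ f t = n).
  exists [set t]; split => //; first exact: A0.
  by move=> u [/= _ fu]; apply: finj; rewrite ?inE// fu ft.
by exists set0; split => // u [/= Au fu]; apply: h; exists u.
Qed.

Lemma pair_support_two_pointP P (a b : T) : P [set: T] = 1 -> a != b ->
  pair_support P = [set (a, b); (b, a)] ->
  two_point P a b (fine (P [set a])).
Proof.
move=> P1 ab Pab; have fin A : P A \is a fin_num.
  by apply: mass1_fin_num => //; exact: discrete_measurable.
have : pair_support P (a, b) by rewrite Pab; left.
rewrite /pair_support /= {1}/pair_law (negbTE ab) => law0.
have Z0 : 0 < (\int[P]_u P [set~ u])^-1.
  rewrite lt_def inve_ge0 integral_ge0// andbT.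
  by apply: contraTneq law0 => ->; rewrite mule0 ltxx.
have pos c : P [set c] != 0 -> 0 < P [set c].
  by move=> h; rewrite lt_def h measure_ge0.
have a0 : 0 < P [set a].
  by apply: pos; apply: contraTneq law0 => ->; rewrite !mul0e ltxx.
have b0 : 0 < P [set b].
  by apply: pos; apply: contraTneq law0 => ->; rewrite mule0 !mul0e ltxx.
(* A third point [t] of positive mass would put (a, t) into the pair support. *)
have rest0 : P (~` ([set a] `|` [set b])) = 0.
  apply: discrete_measure_eq0 => t /not_orP[/= ta tb].
  apply: contrapT => /eqP/pos t0.
  have : pair_support P (a, t).
    rewrite /pair_support /= /pair_law/= ifF ?mule_gt0//.
    by apply/negbTE/eqP => /esym.
  by rewrite Pab => -[[/tb]//|[ba _]]; move: ab; rewrite ba eqxx.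
have sum1 : P [set a] + P [set b] = 1.
  rewrite -P1 -(setUv ([set a] `|` [set b])) measureU ?setICr//; last 2 first.
  - exact: discrete_measurable.
  - exact: discrete_measurable.
  rewrite [X in _ = _ + X]rest0 adde0 measureU//;
    [exact: discrete_measurable..|].
  by apply/seteqP; split => // x [/= ->] /eqP; rewrite (negbTE ab).
have b1 : P [set b] = (1 - fine (P [set a]))%:E.
  by rewrite EFinB fineK// -sum1 addeAC subee// add0e.
split => //.
- by apply: fine_gt0; rewrite a0 -ge0_fin_numE ?fin/=.
- by rewrite -subr_gt0 -lte_fin -b1.
- by rewrite fineK.
Qed.

Section gibbs.
Variables (P Q : {measure set T -> \bar R}) (a b : T) (p : R).
Hypotheses (Pab : two_point P a b p) (Q1 : Q [set: T] = 1).

Let Qfin A : Q A \is a fin_num.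
Proof. by apply: mass1_fin_num => //; exact: discrete_measurable. Qed.

Lemma KL_kl2 : KL P (fun y => Q [set y]) =
  kl2 p (fine (Q [set a])) (fine (Q [set b])).
Proof. by apply: (KL_two_point discT Pab); rewrite ?fineK// fine_ge0. Qed.

Let Qle1 : (fine (Q [set a]) + fine (Q [set b]) <= 1)%R.
Proof.
case: Pab => ab _ _ _ _; rewrite -lee_fin EFinD !fineK// -Q1.
rewrite -measureU; [|exact: discrete_measurable..|].
  by rewrite Q1; apply: mass1_le1 => //; exact: discrete_measurable.
by apply/seteqP; split => // x [/= ->] /eqP; rewrite (negbTE ab).
Qed.

Lemma KL_ge0 : 0 <= KL P (fun y => Q [set y]).
Proof. by case: Pab => *; rewrite KL_kl2; exact: kl2_ge0. Qed.

(** Strict positivity of [kl2] forces [Q] to have the masses of [P] at both atoms; these already sum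
    to one, so both laws vanish elsewhere. *)
Lemma KL_eq0 : KL P (fun y => Q [set y]) = 0 -> forall y, Q [set y] = P [set y].
Proof.
case: (Pab) => ab p0 p1 _ [Pa Pb]; rewrite KL_kl2 => K0.
have [Qa Qb] : fine (Q [set a]) = p /\ fine (Q [set b]) = (1 - p)%R.
  by apply: contrapT => /(kl2_gt0 p0 p1 Qle1); rewrite K0 ltxx.
have Qa' : Q [set a] = p%:E by rewrite -Qa fineK.
have Qb' : Q [set b] = (1 - p)%:E by rewrite -Qb fineK.
have Qab : two_point Q a b p by split.
move=> y; have [->|ya] := eqVneq y a; first by rewrite Pa Qa'.
have [->|yb] := eqVneq y b; first by rewrite Pb Qb'.
by rewrite (two_point_eq0 discT Qab)// (two_point_eq0 discT Pab).
Qed.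

End gibbs.

Lemma KL_refl P a b p : two_point P a b p -> KL P (fun y => P [set y]) = 0.
Proof.
move=> Pab; case: (Pab) => ab p0 p1 P1 [Pa Pb].
by rewrite (KL_kl2 Pab)// Pa Pb kl2_refl.
Qed.

(** Bounds the integrand of a relative entropy against masses 1/2, where a probability ratio is at
    most 2. *)
Lemma lne_div_half_le (u : \bar R) : 0 <= u -> u <= 1 ->
  lne (u / (2^-1)%:E) <= (ln 2)%:E.
Proof.
move=> u0 u1; have l2 : lne 2%:E = (ln 2)%:E :> \bar R by rewrite lne_EFin.
rewrite -l2 inver invr_eq0 (_ : _ == _ = false); last first.
  by apply/negbTE; rewrite pnatr_eq0.
rewrite invrK lee_lne; last 2 first.
- by rewrite in_itv/= leey mule_ge0.
- by rewrite in_itv/= leey lee_fin ler0n.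
by rewrite -[leRHS]mul1e lee_wpmul2r.
Qed.

End discrete_probability.

(** * Measurability over a countable cover and construction of kernels *)

Section measurable_cover.
Context d d' (X : measurableType d) (Z : measurableType d') (I : Type).

Lemma measurable_fun_countable_cover (G : set X) (E : I -> set X) (f : X -> Z) :
  countable [set: I] -> measurable G -> (forall i, measurable (E i)) ->
  G `<=` \bigcup_i E i -> (forall i, measurable_fun (G `&` E i) f) ->
  measurable_fun G f.
Proof.
move=> cI mG mE GE mf _ B mB.
have -> : G `&` f @^-1` B = \bigcup_i (G `&` E i `&` f @^-1` B).
  apply/seteqP; split => [x [Gx fx]|x [i _ [[Gx _] fx]]] //.
  by have [i _ Ei] := GE _ Gx; exists i.
apply: countable_bigcupT_measurable => // i.
by apply: mf => //; exact: measurableI.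
Qed.

End measurable_cover.

Section pker_of.
Context dX dY (X : measurableType dX) (Y : measurableType dY) (R : realType).
Variable k : X -> {measure set Y -> \bar R}.
Hypothesis mk : forall U, measurable U -> measurable_fun [set: X] (k ^~ U).
Hypothesis k1 : forall x, k x [set: Y] = 1.

(** A named copy of [k], to which the kernel and probability structures can be attached. *)
Let pk (_ : forall x, k x [set: Y] = 1) := k.

HB.instance Definition _ := isKernel.Build _ _ X Y R (pk k1) mk.
HB.instance Definition _ := Kernel_isProbability.Build _ _ X Y R (pk k1) k1.

Lemma ex_pker : exists pi : R.-pker X ~> Y, forall x, pi x = k x.
Proof. by exists (pk k1). Qed.

End pker_of.

(** * Bradley-Terry preferences and Bernoulli laws *)

Section bradley_terry_theory.
Context d (X : Type) (Y : measurableType d) (R : realType).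

(** A normalizer S equal to 0 or +oo would give [a] mass 0. Otherwise the two exponentials are pS
    and (1 - p)S, and their sum is S itself. *)
Lemma bt_pref_softmax (r : X -> Y -> \bar R) (x : X) (a b : Y) (p : R) :
  (0 < p)%R -> bt_softmax r x a = p%:E -> bt_softmax r x b = (1 - p)%:E ->
  bt_pref r x a b = p%:E.
Proof.
move=> p0; rewrite /bt_softmax /bt_pref; set S := \esum_(y in _) _.
have S0 : 0 <= S by apply: esum_ge0 => y _; exact: expeR_ge0.
have leS y : expeR (r x y) <= S.
  apply: ereal_sup_ubound; exists [set y]; last by rewrite fsbig_set1.
  by split => //; exact: finite_set1.
have e0 y : 0 <= expeR (r x y) by exact: expeR_ge0.
move: (e0 a) (e0 b) S0 (leS a) (leS b) => {e0 leS}; clearbody S.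
move: (expeR (r x a)) (expeR (r x b)) => ea eb.
case: S => [s| |]//; last first.
  by rewrite invey mule0 => _ _ _ _ _ [p0']; rewrite -p0' ltxx in p0.
case: ea => [u| |]//; case: eb => [v| |]//; rewrite !lee_fin inver.
move=> u0 v0 s0 us vs.
case: ifPn => [/eqP s0'|sn0].
  have -> : u = 0%R by apply/eqP; rewrite eq_le u0 -s0' us.
  by rewrite mul0e => -[p0']; rewrite -p0' ltxx in p0.
rewrite -!EFinM => -[up] [vp]; rewrite -EFinD inver.
have uE : u = (p * s)%R by rewrite -up mulfVK.
have vE : v = ((1 - p) * s)%R by rewrite -vp mulfVK.
have -> : (u + v)%R = s by rewrite uE vE; ring.
by rewrite (negbTE sn0) -EFinM up.
Qed.

End bradley_terry_theory.

Lemma bernoulli_prob1E {R : realType} (p : R) (z : bool) : (0 <= p <= 1)%R ->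
  bernoulli_prob p [set z] = (if z then p else 1 - p)%:E.
Proof.
move=> p01; rewrite bernoulli_probE// !diracE !in_set1.
by case: z; rewrite /= ?mule1 ?mule0 ?adde0 ?add0e.
Qed.

Lemma two_point_bernoulli {R : realType} (p : R) : (0 < p)%R -> (p < 1)%R ->
  two_point (bernoulli_prob p : {measure set bool -> \bar R}) true false p.
Proof.
move=> p0 p1; have p01 : (0 <= p <= 1)%R by rewrite !ltW.
split => //; first exact: probability_setT.
by split; [have := bernoulli_prob1E true p01|
           have := bernoulli_prob1E false p01].
Qed.

Lemma discrete_bool : discrete_space bool.
Proof. by split=> //; exact: countableP. Qed.

(** * Preference data: measurability, sign and finiteness of the losses *)

Section preference_data_theory.
Context dX dY (X : measurableType dX) (Y : measurableType dY) (R : realType).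
Variables (D : probability X R) (good bad : set X) (r : X -> Y -> \bar R).
Variables (pref pistar : R.-pker X ~> Y).
Variable dist :
  {measure set Y -> \bar R} -> {measure set Y -> \bar R} -> \bar R.
Hypothesis pd : preference_data D good bad r pref pistar dist.

Let discY : discrete_space Y := pd_discrete pd.
Let mgood : measurable good := pd_good_meas pd.
Let mbad : measurable bad := pd_bad_meas pd.
Let G := good `|` bad.
Let mG : measurable G := measurableU _ _ mgood mbad.
Let mY (A : set Y) : measurable A := discrete_measurable discY A.

Let DGC : D (~` G) = 0.
Proof. by rewrite probability_setC// [D G](pd_cover pd) subee. Qed.

(** Holds without measurability of [f], so it also applies to the supervised integrand. *)
Let integral_G (f : X -> \bar R) : \int[D]_x f x = \int[D]_(x in G) f x.
Proof.
by rewrite (integral_negligibleC _ (measurableC mG) DGC) setCK.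
Qed.

Let two_point_pref x : G x -> exists a b p, two_point (pref x) a b p.
Proof.
move=> /(pd_pair pd)[a [b [ab supp _ _]]]; exists a, b, (fine (pref x [set a])).
by apply: pair_support_two_pointP => //; exact: prob_kernel.
Qed.

(* The support pair of pref x need not be a measurable function of x; Y being
   countable, the cells where it is constant reduce measurability to a fixed
   pair. *)
Let cell (i : Y * Y) : set X :=
  [set x | [/\ i.1 != i.2, 0 < pref x [set i.1], 0 < pref x [set i.2] &
               pref x [set i.1] + pref x [set i.2] = 1]].

Let measurable_cell i : measurable (cell i).
Proof.
have [i12|i12] := eqVneq i.1 i.2.
  rewrite (_ : cell i = set0)//; apply/seteqP; split => // x [].
  by rewrite i12 eqxx.
have mk y : measurable_fun [set: X] (fun x => pref x [set y]).
  by apply: measurable_kernel.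
have -> : cell i = [set x | 0 < pref x [set i.1]] `&`
    ([set x | 0 < pref x [set i.2]] `&`
    (fun x => pref x [set i.1] + pref x [set i.2]) @^-1` [set 1]).
  by apply/seteqP; split => [x []|x [? []]].
have mpos y : measurable [set x | 0 < pref x [set y]].
  by rewrite -[X in measurable X]setTI; exact: emeasurable_fun_o_infty.
apply: measurableI => //; apply: measurableI => //.
rewrite -[X in measurable X]setTI.
by apply: emeasurable_funD => //; exact: emeasurable_set1.
Qed.

Let cell_two_point i x : cell i x ->
  two_point (pref x) i.1 i.2 (fine (pref x [set i.1])).
Proof.
move=> [i12 a0 b0 ab1]; have fin y : pref x [set y] \is a fin_num.
  by apply: mass1_fin_num => //; exact: prob_kernel.
have b1 : pref x [set i.2] = (1 - fine (pref x [set i.1]))%:E.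
  by rewrite EFinB fineK// -ab1 addeAC subee// add0e.
split => //.
- by apply: fine_gt0; rewrite a0 -ge0_fin_numE ?fin/=.
- by rewrite -subr_gt0 -lte_fin -b1.
- exact: prob_kernel.
- by rewrite fineK.
Qed.

Let G_cell : G `<=` \bigcup_i cell i.
Proof.
move=> x /two_point_pref[a [b [p [ab p0 p1 _ [Pa Pb]]]]].
exists (a, b) => //; split => //=; rewrite ?Pa ?Pb ?lte_fin ?subr_gt0//.
by rewrite -EFinD subrKC.
Qed.

Let measurable_on_G d (Z : measurableType d) (f : X -> Z) :
  (forall a b, measurable_fun (G `&` cell (a, b)) f) -> measurable_fun G f.
Proof.
move=> mf; apply: (measurable_fun_countable_cover _ mG measurable_cell G_cell).
  by rewrite -setXTT; apply: countableX; exact: discY.1.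
by move=> [a b]; exact: mf.
Qed.

Let u (pi : R.-pker X ~> Y) x := KL (pref x) (fun y => pi x [set y]).

Let measurable_u pi : measurable_fun G (u pi).
Proof.
apply: measurable_on_G => a b; have mGc : measurable (G `&` cell (a, b)).
  exact: measurableI.
have mk (k : R.-pker X ~> Y) y :
    measurable_fun (G `&` cell (a, b)) (fun x => fine (k x [set y])).
  apply: measurableT_comp => //; apply: measurable_funTS.
  exact: measurable_kernel.
(* On a cell the pair is fixed, and the relative entropy is a measurable function of finitely many
   kernel masses. *)
apply: (@eq_measurable_fun _ _ _ _ _ (fun x => kl2 (fine (pref x [set a]))
    (fine (pi x [set a])) (fine (pi x [set b])))).
  move=> x; rewrite inE => -[_ /cell_two_point Pab].
  by rewrite /u (KL_kl2 discY Pab)//; exact: prob_kernel.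
exact: measurable_kl2.
Qed.

Let u_ge0 pi x : G x -> 0 <= u pi x.
Proof.
move=> /two_point_pref[a [b [p Pab]]].
by apply: (KL_ge0 discY Pab); exact: prob_kernel.
Qed.

Let l_unsup_ge0 pi : 0 <= l_unsup D pref pi.
Proof. by rewrite /l_unsup integral_G; apply: integral_ge0; exact: u_ge0. Qed.

Let s (pi : R.-pker X ~> Y) x : \bar R := \esum_(y in [set: Y * Y])
  (pair_law (pref x) y *
   KL (bernoulli_prob (fine (bt_pref r x y.1 y.2))) (p_theta pi x y.1 y.2)).

(* An esum is a supremum including the empty partial sum, so no sign condition
   on the KL terms is needed. *)
Let s_ge0 pi x : 0 <= s pi x.
Proof.
by apply: ereal_sup_ubound; exists set0; [exact: fsets_set0|rewrite fsbig_set0].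
Qed.

Let l_sup_ge0 pi : 0 <= l_sup D r pref pi.
Proof. by apply: integral_ge0 => x _; exact: s_ge0. Qed.

Let eq_s (pi pi' : R.-pker X ~> Y) x : pi x = pi' x -> s pi x = s pi' x.
Proof. by rewrite /s /p_theta => ->. Qed.

(** At a good prompt the reference masses p and 1 - p are softmax masses, so the preference
    probability is p; [p_theta] is then the same Bernoulli law and every KL term vanishes. *)
Let s_good (pi : R.-pker X ~> Y) x : good x -> pi x = pref x -> s pi x = 0.
Proof.
move=> gx pix; have [a [b [p Pab]]] := two_point_pref (or_introl gx).
have Pba : two_point (pref x) b a (1 - p)%R.
  case: Pab => ab p0 p1 P1 [Pa Pb]; split => //; rewrite 1?eq_sym ?subKr//.
  - by rewrite subr_gt0.
  - by rewrite ltrBlDr ltrDl.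
have term0 a' b' p' : two_point (pref x) a' b' p' ->
    KL (bernoulli_prob (fine (bt_pref r x a' b'))) (p_theta pi x a' b') = 0.
  move=> [ab p0 p1 P1 [Pa Pb]].
  rewrite (bt_pref_softmax (p := p'))//=; last 2 first.
  - by rewrite -(pd_BT_optimal pd) -(pd_good pd gx).
  - by rewrite -(pd_BT_optimal pd) -(pd_good pd gx).
  have B2 := two_point_bernoulli p0 p1.
  have q1 : pi x [set a'] + pi x [set b'] = 1.
    by rewrite pix Pa Pb -EFinD subrKC.
  rewrite (KL_two_point discrete_bool B2 (qa := p') (qb := 1 - p')).
  - exact: kl2_refl.
  - exact: ltW.
  - by rewrite subr_ge0 ltW.
  - by rewrite /p_theta q1 pix Pa inve1 mule1.
  - by rewrite /p_theta q1 pix Pb inve1 mule1.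
apply: esum1 => y _; rewrite (pair_law_two_pointE discY Pab).
case: ifP => [/orP[/eqP ->|/eqP ->]|_]; last by rewrite mul0e.
- by rewrite (term0 _ _ _ Pab) mule0.
- by rewrite (term0 _ _ _ Pba) mule0.
Qed.

(* Its two losses are at most log 2, whereas pref itself may have infinite
   supervised loss on the bad prompts. *)
Let uniform_pair_policy : exists pi : R.-pker X ~> Y, forall x, G x ->
  exists a b p, two_point (pref x) a b p /\
    forall A, pi x A = (2^-1)%:E * \d_a A + (2^-1)%:E * \d_b A.
Proof.
(* This selection need not be measurable; off [G] it is fixed to [point] to make the kernel constant
   there. *)
have /choice[f fP] x : exists y : Y * Y,
    (G x -> exists p, two_point (pref x) y.1 y.2 p) /\
    (~ G x -> y = (point, point)).
  have [Gx|nGx] := pselect (G x); last by exists (point, point).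
  have [a [b [p Pab]]] := two_point_pref Gx.
  by exists (a, b); split => // _; exists p.
have h0 : (0 <= 2^-1 :> R)%R by rewrite invr_ge0.
pose h := NngNum h0.
pose k x : {measure set Y -> \bar R} :=
  measure_add (mscale h \d_((f x).1)) (mscale h \d_((f x).2)).
have kE x A : k x A =
    (2^-1)%:E * \d_((f x).1) A + (2^-1)%:E * \d_((f x).2) A.
  by rewrite [LHS]measure_addE.
have mk U : measurable U -> measurable_fun [set: X] (k ^~ U).
  move=> mU; rewrite -(setUv G); apply/measurable_funU => //.
    exact: measurableC.
  split; last first.
    apply: (@eq_measurable_fun _ _ _ _ _
      (cst ((2^-1)%:E * \d_point U + (2^-1)%:E * \d_point U))) => //.
    by move=> x; rewrite inE kE /= => /(fP x).2 ->.
  apply: measurable_on_G => a b.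
  apply: (@eq_measurable_fun _ _ _ _ _
    (cst ((2^-1)%:E * \d_a U + (2^-1)%:E * \d_b U))) => //.
  move=> x; rewrite inE => -[Gx /cell_two_point/= Pab].
  have [p Pf] := (fP x).1 Gx; rewrite kE /=.
  (* On a cell the selected pair is known up to order, and the uniform mixture is symmetric in its
     two points, so the kernel is constant on the cell. *)
  have : pair_support (pref x) ((f x).1, (f x).2).
    by rewrite (pair_support_two_point discY Pf); left.
  rewrite (pair_support_two_point discY Pab) => -[[-> ->]//|[-> ->]].
  by rewrite addeC.
have k1 x : k x [set: Y] = 1.
  by rewrite kE !diracT !mule1 -EFinD -div1r -splitr.
have [pi piE] := ex_pker mk k1; exists pi => x Gx.
have [p Pf] := (fP x).1 Gx; exists (f x).1, (f x).2, p; split => // A.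
by rewrite piE kE.
Qed.

Let ln2_ge0 : (0 <= ln 2 :> R)%R.
Proof. by rewrite ln_ge0// ler1n. Qed.

Let integral_le_on_G (f : X -> \bar R) (c : R) : (0 <= c)%R ->
  (forall x, G x -> f x <= c%:E) -> \int[D]_x f x <= c%:E.
Proof.
move=> c0 fc; rewrite integral_G integral_mkcond.
apply: integral_le_bound_cst => //; first exact: probability_setT.
by move=> x; rewrite patchE; case: ifPn => [/set_mem/fc//|_]; rewrite lee_fin.
Qed.

Let finite_loss_policy : exists pi : R.-pker X ~> Y,
  l_sup D r pref pi < +oo /\ l_unsup D pref pi < +oo.
Proof.
have [pi piE] := uniform_pair_policy; exists pi.
suff [hs hu] : l_sup D r pref pi <= (ln 2)%:E /\
    l_unsup D pref pi <= (ln 2)%:E.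
  by split; [apply: le_lt_trans hs _|apply: le_lt_trans hu _]; rewrite ltry.
split; apply: integral_le_on_G => // x /piE[a [b [p [Pab pix]]]];
    case: (Pab) => ab p0 p1 P1 _.
  (* Writing log 2 as its own average under the pair law allows a comparison term by term. *)
  rewrite -[leRHS](esum_pair_law discY Pab (c := (ln 2)%:E))//.
  apply: le_esum => y _.
  rewrite (pair_law_two_pointE discY Pab).
  have KLle y1 y2 : pi x [set y1] = (2^-1)%:E -> pi x [set y2] = (2^-1)%:E ->
      KL (bernoulli_prob (fine (bt_pref r x y1 y2))) (p_theta pi x y1 y2)
      <= (ln 2)%:E.
    move=> h1 h2; apply: integral_le_bound_cst => //.
      exact: probability_setT.
    move=> z; have -> : p_theta pi x y1 y2 z = (2^-1)%:E.
      rewrite /p_theta h1 h2 -EFinD -div1r -splitr inve1 mule1.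
      by case: z; rewrite ?h1 ?h2 div1r.
    by apply: lne_div_half_le => //; exact: probability_le1.
  have pa : pi x [set a] = (2^-1)%:E.
    by rewrite pix !diracE !in_set1 eqxx eq_sym (negbTE ab) mule1 mule0 adde0.
  have pb : pi x [set b] = (2^-1)%:E.
    by rewrite pix !diracE !in_set1 eqxx (negbTE ab) mule1 mule0 add0e.
  case: ifP => [|_]; last by rewrite !mul0e.
  by move=> /orP[/eqP ->|/eqP ->]; apply: lee_wpmul2l;
    rewrite ?lee_fin ?invr_ge0//; exact: KLle.
apply: integral_le_bound_cst => // y.
have [ya|ya] := eqVneq y a; last first.
  have [yb|yb] := eqVneq y b; last first.
    (* Off the pair the reference mass is 0, and the logarithm takes the value -oo. *)
    by rewrite (two_point_eq0 discY Pab)// mul0e le0_lneNy// leNye.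
  rewrite pix !diracE !in_set1 yb eqxx (negbTE ab) mule1 mule0 add0e.
  by apply: lne_div_half_le => //; apply: mass1_le1.
rewrite pix !diracE !in_set1 ya eqxx eq_sym (negbTE ab) mule1 mule0 adde0.
by apply: lne_div_half_le => //; apply: mass1_le1.
Qed.

(** * Minimizers agree with the optimal policy on good prompts *)

Variables (lambda : R) (pihat : R.-pker X ~> Y).
Hypothesis lambda_gt0 : (0 < lambda)%R.
Hypothesis pihat_argmin : is_TYPO_argmin D r lambda pref pihat.

Let pihat_finite : l_sup D r pref pihat < +oo /\ l_unsup D pref pihat < +oo.
Proof.
have [pi [hs hu]] := finite_loss_policy.
have : l_TYPO D r lambda pref pihat < +oo.
  apply: (le_lt_trans (pihat_argmin pi)); rewrite /l_TYPO.
  by rewrite lte_add_pinfty// lte_mul_pinfty// lee_fin ltW.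
rewrite /l_TYPO => h; split.
  by apply: le_lt_trans h; rewrite leeDl// mule_ge0// lee_fin ltW.
rewrite ltey; apply/eqP => uy; move: h; rewrite uy gt0_muley ?lte_fin//.
by rewrite addey// gt_eqF// (lt_le_trans _ (l_sup_ge0 _))// ltNy0.
Qed.

(** The competitor: the minimizer with its good prompts overwritten by the reference policy. *)
Let good_policy : exists pi : R.-pker X ~> Y,
  (forall x, good x -> pi x = pref x) /\ (forall x, ~ good x -> pi x = pihat x).
Proof.
pose k x : {measure set Y -> \bar R} :=
  if x \in good then pref x : {measure set Y -> \bar R} else pihat x.
have kg x : good x -> k x = pref x by move=> gx; rewrite /k mem_set.
have kb x : ~ good x -> k x = pihat x by move=> gx; rewrite /k memNset.
have mk U : measurable U -> measurable_fun [set: X] (k ^~ U).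
  move=> mU; rewrite -(setUv good); apply/measurable_funU => //.
    exact: measurableC.
  split.
    apply: (@eq_measurable_fun _ _ _ _ _ (pref ^~ U)).
      by move=> x /set_mem /kg ->.
    by apply: measurable_funTS; exact: measurable_kernel.
  apply: (@eq_measurable_fun _ _ _ _ _ (pihat ^~ U)).
    by move=> x /set_mem /kb ->.
  by apply: measurable_funTS; exact: measurable_kernel.
have k1 x : k x [set: Y] = 1 by rewrite /k; case: ifP => _; exact: prob_kernel.
have [pi piE] := ex_pker mk k1; exists pi.
by split=> x hx; rewrite piE; [exact: kg|exact: kb].
Qed.

Let l_unsup_good_eq0 : \int[D]_(x in good) u pihat x = 0.
Proof.
have [hs hu] := pihat_finite; have [pi [pig pib]] := good_policy.
(* The supervised integrand of the competitor is 0 on good prompts and unchanged elsewhere. *)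
have sle : l_sup D r pref pi <= l_sup D r pref pihat.
  apply: ge0_le_integral_nonmeasurable => x; first exact: s_ge0.
  have [gx|gx] := pselect (good x).
    by rewrite -/(s pi x) (s_good gx (pig _ gx)); exact: s_ge0.
  by rewrite -/(s pi x) (eq_s (pib _ gx)).
(* Finiteness lets the supervised loss cancel, which leaves a comparison of the unsupervised
   losses. *)
have finS : l_sup D r pref pihat \is a fin_num by rewrite ge0_fin_numE.
have ule : l_unsup D pref pihat <= l_unsup D pref pi.
  have := pihat_argmin pi; rewrite /l_TYPO => h.
  have : l_sup D r pref pihat + lambda%:E * l_unsup D pref pihat <=
         l_sup D r pref pihat + lambda%:E * l_unsup D pref pi.
    by apply: (le_trans h); rewrite leeD2r.
  by rewrite leeD2lE// lee_pmul2l// lte_fin.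
have splitu k : l_unsup D pref k =
    \int[D]_(x in good) u k x + \int[D]_(x in bad) u k x.
  rewrite /l_unsup integral_G ge0_integral_setU//.
  - exact: measurable_u.
  - by move=> x; exact: u_ge0.
  - by rewrite disj_set2E (pd_disjoint pd) eqxx.
move: ule hu; rewrite !splitu [X in _ <= X + _](_ : _ = 0); last first.
  apply: integral0_eq => x gx; rewrite /u (pig _ gx).
  by have [a [b [p Pab]]] := two_point_pref (or_introl gx);
    exact: (KL_refl discY Pab).
rewrite [X in _ <= _ + X](_ : _ = \int[D]_(x in bad) u pihat x); last first.
  apply: eq_integral => x /set_mem bx; rewrite /u pib// => gx.
  by have : (good `&` bad) x by []; rewrite (pd_disjoint pd).
have gu0 : 0 <= \int[D]_(x in good) u pihat x.
  by apply: integral_ge0 => x gx; apply: u_ge0; left.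
have bu0 : 0 <= \int[D]_(x in bad) u pihat x.
  by apply: integral_ge0 => x gx; apply: u_ge0; right.
(* The bad prompts contribute the same amount to both sides; it is finite as part of a finite total,
   and cancels. *)
move=> h hu; apply/eqP; rewrite eq_le gu0 andbT.
move: h; rewrite leeD2rE// ge0_fin_numE//.
by apply: le_lt_trans hu; rewrite leeDr.
Qed.

Lemma TYPO_argmin_good :
  {ae D, forall x, good x -> forall y, pihat x [set y] = pistar x [set y]}.
Proof.
have mu : measurable_fun good (u pihat).
  exact: measurable_funS mG (@subsetUl _ good bad) (measurable_u pihat).
have /(ae_eq_integral_abs _ mgood mu) : \int[D]_(x in good) `|u pihat x| = 0.
  rewrite -l_unsup_good_eq0; apply: eq_integral => x /set_mem gx.
  by rewrite gee0_abs// u_ge0//; left.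
apply: filterS => x /= h gx y.
have [a [b [p Pab]]] := two_point_pref (or_introl gx).
rewrite -(pd_good pd gx); apply: (KL_eq0 discY Pab); last exact: h.
exact: prob_kernel.
Qed.

End preference_data_theory.

(** * Total variation as a distance *)

Section total_variation.
Context d (T : measurableType d) (R : realType).

Lemma is_distance_tv_dist : is_distance (@tv_dist _ T R).
Proof.
move=> p q p1 q1.
have tv0 : 0 <= tv_dist p q.
  by apply: ereal_sup_ubound; exists set0 => //; rewrite !measure0 sube0 abse0.
split => //; split => [tvE A mA|pq].
  have : `|p A - q A| == 0.
    rewrite eq_le abse_ge0 andbT -[leRHS]tvE.
    by apply: ereal_sup_ubound; exists A.
  by rewrite abse_eq0 sube_eq ?add0e ?mass1_fin_num// => /eqP.
apply/eqP; rewrite eq_le tv0 andbT; apply: ge_ereal_sup => _ [A mA <-].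
by rewrite pq// subee ?abse0// mass1_fin_num.
Qed.

End total_variation.

(** * An example with two prompts and two responses *)

Section boolean_example.
Context {R : realType}.

Lemma tv_dist_bernoulli (p q : R) : (0 <= p <= 1)%R -> (0 <= q <= 1)%R ->
  tv_dist (bernoulli_prob p : {measure set bool -> \bar R}) (bernoulli_prob q) =
  `|p - q|%:E.
Proof.
move=> p01 q01; apply/eqP; rewrite eq_le; apply/andP; split; last first.
  apply: ereal_sup_ubound; exists [set true] => //=.
  (* The supremum is attained at a singleton: the other singleton gives the same gap, and the empty
     and full events give 0. *)
  by rewrite !bernoulli_prob1E.
apply: ge_ereal_sup => _ [A mA <-] /=.
have bE (u : R) : (0 <= u <= 1)%R -> bernoulli_prob u A =
    (u * (true \in A)%:R + (1 - u) * (false \in A)%:R)%:E.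
  by move=> u01; rewrite bernoulli_probE// !diracE.
rewrite !bE// -EFinB /= lee_fin.
case: (true \in A); case: (false \in A); rewrite ?mulr1 ?mulr0.
- by rewrite !subrKC subrr normr0.
- by rewrite !addr0.
- by rewrite !add0r opprB addrC addrA subrK distrC.
- by rewrite !addr0 subrr normr0.
Qed.

Lemma bernoulli_policy (w : bool -> R) : exists pi : R.-pker bool ~> bool,
  forall x, pi x = bernoulli_prob (w x) :> {measure set bool -> \bar R}.
Proof.
apply: (@ex_pker _ _ _ _ _ (fun x => bernoulli_prob (w x))) => [U _|x].
  exact: (discrete_measurable_fun discrete_bool).
exact: probability_setT.
Qed.

Lemma kl2_sym (p qa qb : R) : kl2 (1 - p)%R qb qa = kl2 p qa qb.
Proof. by rewrite /kl2 subKr andbC addrC. Qed.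

(* The pointwise loss is (1 + lambda) KL[m || q] plus a constant. *)
Lemma kl2_mixture_min (lambda p w qa qb : R)
    (m := ((p + lambda * w) / (1 + lambda))%R) :
  (0 < lambda)%R -> (0 < p)%R -> (p < 1)%R -> (0 < w)%R -> (w < 1)%R ->
  (qa + qb <= 1)%R ->
  kl2 p m (1 - m)%R + lambda%:E * kl2 w m (1 - m)%R <=
  kl2 p qa qb + lambda%:E * kl2 w qa qb.
Proof.
move=> l0 p0 p1 w0 w1 q1; have l1 : (0 < 1 + lambda)%R by lra.
have m0 : (0 < m)%R by rewrite divr_gt0// addr_gt0// mulr_gt0.
have mE : (m * (1 + lambda) = p + lambda * w)%R by rewrite divfK ?gt_eqF.
have m1 : (m < 1)%R by rewrite ltr_pdivrMr// mul1r ltrD// gtr_pMr.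
have := kl2_ge0 m0 m1 q1; rewrite /kl2 m0 subr_gt0 m1/=.
(* If a mass of the competitor is not positive, the right-hand side is +oo. *)
case: ifP => _; last by rewrite gt0_muley ?lte_fin// addye// !leey.
rewrite -!EFinM -!EFinD !lee_fin => h.
have := mulr_ge0 (ltW l1) h.
set A := (ln m); set B := (ln (1 - m)); set qA := ln qa; set qB := ln qb.
have -> : ((1 + lambda) * (m * (A - qA) + (1 - m) * (B - qB)) =
  (p + lambda * w) * (A - qA) + (1 + lambda - (p + lambda * w)) * (B - qB))%R.
  by rewrite -mE; ring.
lra.
Qed.

Variables (lambda : R) (w : bool -> R).
Hypotheses (lambda_gt0 : (0 < lambda)%R)
  (w_gt0 : forall x, (0 < w x)%R) (w_lt1 : forall x, (w x < 1)%R).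
Variable pref : R.-pker bool ~> bool.
Hypothesis prefE : forall x,
  pref x = bernoulli_prob (w x) :> {measure set bool -> \bar R}.

(** A constant reward makes the preferences and the optimal policy uniform at both prompts. *)
Let r (x y : bool) : \bar R := 0.
Let half : R := (2^-1)%R.
Let D : probability bool R := bernoulli_prob half.

Let half_gt0 : (0 < half)%R. Proof. by rewrite invr_gt0. Qed.
Let half_lt1 : (half < 1)%R. Proof. by rewrite invf_lt1// ltr1n. Qed.
Let onem_half : (1 - half = half)%R. Proof. by rewrite /half; lra. Qed.

Lemma bt_pref_cst0 x a b : bt_pref r x a b = half%:E.
Proof.
by rewrite /bt_pref /r expeR0 -EFinD -mulr2n inver pnatr_eq0 /= mul1e.
Qed.

Lemma bt_softmax_cst0 x y : bt_softmax r x y = half%:E.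
Proof.
rewrite /bt_softmax /r expeR0 (_ : \esum_(_ in _) _ = 2%:E); last first.
  rewrite setT_bool esum_fset// fsbigU/=; last first.
  - by move=> z [/= -> ].
  - exact: finite_set1.
  - exact: finite_set1.
  by rewrite !fsbig_set1 -EFinD.
by rewrite inver pnatr_eq0 /= mul1e.
Qed.

Let prefP x : two_point (pref x) true false (w x).
Proof. by rewrite prefE; exact: two_point_bernoulli. Qed.

Let q (pi : R.-pker bool ~> bool) x y := fine (pi x [set y]).

Let piE (pi : R.-pker bool ~> bool) x y : pi x [set y] = (q pi x y)%:E.
Proof.
by rewrite fineK//; apply: mass1_fin_num => //; exact: prob_kernel.
Qed.

Let q_ge0 pi x y : (0 <= q pi x y)%R. Proof. exact: fine_ge0. Qed.

Let q_sum pi x : (q pi x true + q pi x false = 1)%R.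
Proof.
apply/EFin_inj; rewrite EFinD -!piE -(prob_kernel (s := pi) x) setT_bool.
by rewrite measureU//; apply/seteqP; split => // z [/= ->].
Qed.

Let loss pi x := kl2 half (q pi x true) (q pi x false) +
  lambda%:E * kl2 (w x) (q pi x true) (q pi x false).

Let loss_ge0 pi x : 0 <= loss pi x.
Proof.
by rewrite adde_ge0 ?mule_ge0 ?kl2_ge0 ?q_sum// lee_fin ltW.
Qed.

(** With two responses the policy masses sum to one, so [p_theta] is the policy itself; as the
    preference is 1/2, both orders of the pair contribute the same [kl2]. Minimization can then be
    done prompt by prompt. *)
Let l_TYPOE pi : l_TYPO D r lambda pref pi = \int[D]_x loss pi x.
Proof.
have mb (f : bool -> \bar R) : measurable_fun setT f.
  exact: (discrete_measurable_fun discrete_bool).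
have supE : l_sup D r pref pi =
    \int[D]_x kl2 half (q pi x true) (q pi x false).
  apply: eq_integral => x _.
  rewrite -[RHS](esum_pair_law discrete_bool (prefP x)); last first.
    by rewrite kl2_ge0// q_sum.
  have B2 := two_point_bernoulli half_gt0 half_lt1.
  apply: eq_esum => -[y1 y2] _.
  rewrite (pair_law_two_pointE discrete_bool (prefP x)) bt_pref_cst0 /=.
  have pt z1 z2 z : z1 != z2 -> p_theta pi x z1 z2 z =
      (q pi x (if z then z1 else z2))%:E.
    rewrite /p_theta !piE -EFinD => z12.
    rewrite (_ : (q pi x z1 + q pi x z2)%R = 1%R) ?inve1 ?mule1//.
    by case: z1 z2 z12 => [] []// _; rewrite ?q_sum// addrC q_sum.
  case: ifP => [/orP[/eqP[-> ->]|/eqP[-> ->]]|_]; last by rewrite !mul0e.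
    by rewrite (KL_two_point discrete_bool B2 (qa := q pi x true)
      (qb := q pi x false)) ?pt.
  rewrite (KL_two_point discrete_bool B2 (qa := q pi x false)
    (qb := q pi x true)) ?pt//.
  by rewrite -[in RHS]kl2_sym onem_half.
have unsupE : l_unsup D pref pi =
    \int[D]_x kl2 (w x) (q pi x true) (q pi x false).
  apply: eq_integral => x _; apply: (KL_kl2 discrete_bool (prefP x)).
  exact: prob_kernel.
rewrite /l_TYPO supE unsupE -ge0_integralZl//; last 2 first.
- by move=> x _; rewrite kl2_ge0// q_sum.
- by rewrite lee_fin ltW.
rewrite -ge0_integralD//; last 2 first.
- by move=> x _; rewrite kl2_ge0// q_sum.
- by move=> x _; rewrite mule_ge0 ?kl2_ge0 ?q_sum// lee_fin ltW.
Qed.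

Lemma mixture_TYPO_argmin (pihat : R.-pker bool ~> bool) :
  (forall x, pihat x =
     bernoulli_prob ((half + lambda * w x) / (1 + lambda))%R
     :> {measure set bool -> \bar R}) ->
  is_TYPO_argmin D r lambda pref pihat.
Proof.
move=> pihatE pi; rewrite !l_TYPOE.
apply: ge0_le_integral_nonmeasurable => // x.
set m := ((half + lambda * w x) / (1 + lambda))%R.
have l1 : (0 < 1 + lambda)%R by rewrite addr_gt0.
have m0 : (0 <= m)%R by rewrite divr_ge0 ?addr_ge0 ?mulr_ge0 ?ltW.
have m1 : (m <= 1)%R.
  by rewrite ler_pdivrMr// mul1r lerD ?ltW// gtr_pMr.
have m01 : (0 <= m <= 1)%R by rewrite m0.
have qE y : q pihat x y = if y then m else (1 - m)%R.
  by rewrite /q pihatE; have := bernoulli_prob1E y m01 => /= ->.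
by rewrite /loss !qE; apply: kl2_mixture_min => //; rewrite q_sum.
Qed.

End boolean_example.

Theorem proposition3 (R : realType) (lambda : R) (lambda_gt0 : (0 < lambda)%R) :
  (forall (dX dY : measure_display)
      (X : measurableType dX) (Y : measurableType dY)
      (D : probability X R) (good bad : set X) (r : X -> Y -> \bar R)
      (pref pistar pihat : R.-pker X ~> Y)
      (dist : {measure set Y -> \bar R} -> {measure set Y -> \bar R} -> \bar R),
    preference_data D good bad r pref pistar dist ->
    is_TYPO_argmin D r lambda pref pihat ->
    {ae D, forall x, good x -> forall y, pihat x [set y] = pistar x [set y]} /\
    (forall x, good x -> measurable [set x] -> 0 < D [set x] ->
       forall y, pihat x [set y] = pistar x [set y])) /\
  (exists (dX dY : measure_display)
      (X : measurableType dX) (Y : measurableType dY)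
      (D : probability X R) (good bad : set X) (r : X -> Y -> \bar R)
      (pref pistar pihat : R.-pker X ~> Y),
    [/\ preference_data D good bad r pref pistar (@tv_dist _ Y R),
        is_TYPO_argmin D r lambda pref pihat,
        0 < D good /\ 0 < D bad,
        (forall x, good x -> forall y, pihat x [set y] = pistar x [set y]) &
        (forall x, bad x ->
           tv_dist (pihat x) (pistar x) <
           tv_dist (pref x) (pistar x))]).
Proof.
split=> [dX dY X Y D good bad r pref pistar pihat dist pd pihat_argmin|].
  have ae_good := TYPO_argmin_good pd lambda_gt0 pihat_argmin.
  split => // x gx mx Dx; apply: contrapT => h.
  (* A prompt of positive mass cannot lie in the exceptional null set. *)
  have [N [mN N0 hN]] := ae_good.
  suff Dx0 : D [set x] = 0 by rewrite Dx0 ltxx in Dx.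
  apply: (subset_measure0 mx mN _ N0) => _ ->; apply: hN => /= hx.
  exact/h/hx.
pose half : R := (2^-1)%R.
(* The prompt [true] is good, with reference mass 1/2 as in the optimal policy; [false] is bad, and
   1/4 may be any other value in (0, 1). *)
pose w (x : bool) : R := if x then half else (4^-1)%R.
pose m x := ((half + lambda * w x) / (1 + lambda))%R.
have half0 : (0 < half)%R by rewrite invr_gt0.
have half1 : (half < 1)%R by rewrite invf_lt1// ltr1n.
have w0 x : (0 < w x)%R by rewrite /w; case: x; rewrite // invr_gt0.
have w1 x : (w x < 1)%R by rewrite /w; case: x; rewrite // invf_lt1// ltr1n.
have l1 : (0 < 1 + lambda)%R by rewrite addr_gt0.
have bounds (u : R) : (0 < u)%R -> (u < 1)%R -> (0 <= u <= 1)%R.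
  by move=> u0 u1; rewrite !ltW.
have h01 := bounds _ half0 half1; have w01 x := bounds _ (w0 x) (w1 x).
have m01 x : (0 <= m x <= 1)%R.
  apply/andP; split; first by rewrite divr_ge0 ?addr_ge0 ?mulr_ge0 ?ltW.
  by rewrite /m ler_pdivrMr// mul1r lerD ?ltW// gtr_pMr.
have mt : m true = half.
  by rewrite /m /w; field; rewrite gt_eqF.
have [pref prefE] := bernoulli_policy w.
have [pistar pistarE] := bernoulli_policy (fun=> half).
have [pihat pihatE] := bernoulli_policy m.
exists _, _, bool, bool, (bernoulli_prob half), [set true], [set false],
  (fun _ _ => 0), pref, pistar, pihat; split.
- split.
  + exact: discrete_bool.
  + by [].
  + by [].
  + by apply/seteqP; split => // x [/= ->].
  + by rewrite -setT_bool probability_setT.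
  + move=> x _; exists true, false; split => //.
    * rewrite prefE; apply: (pair_support_two_point discrete_bool).
      exact: two_point_bernoulli.
    * by rewrite bt_pref_cst0 lte_fin.
    * by rewrite bt_pref_cst0 lte_fin.
  + move=> x y; rewrite bt_softmax_cst0 pistarE.
    have := bernoulli_prob1E y h01 => /= ->; congr EFin.
    by case: y; rewrite // /half; lra.
  + exact: is_distance_tv_dist.
  + by move=> x -> y; rewrite prefE pistarE.
  + move=> x ->; rewrite prefE pistarE tv_dist_bernoulli// lte_fin normr_gt0.
    by rewrite /w /half; lra.
- exact: (mixture_TYPO_argmin lambda_gt0 w0 w1 prefE pihatE).
- split.
  + by have := bernoulli_prob1E true h01 => /= ->; rewrite lte_fin.
  + have := bernoulli_prob1E false h01 => /= ->.
    by rewrite lte_fin subr_gt0.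
- by move=> x -> y; rewrite pihatE pistarE mt.
- move=> x ->; rewrite !prefE !pihatE !pistarE !tv_dist_bernoulli// lte_fin.
  (* The mixture contracts the deviation from 1/2 by the factor lambda / (1 + lambda) < 1. *)
  have -> : (m false - half = lambda / (1 + lambda) * (w false - half))%R.
    by rewrite /m; field; rewrite gt_eqF.
  rewrite normrM ger0_norm ?divr_ge0 ?ltW// gtr_pMl.
    by rewrite ltr_pdivrMr// mul1r ltrDr.
  by rewrite normr_gt0 /w /half; lra.
Qed.
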